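(* Let $k$ be a positive integer and consider the $k$-th order system of two rational difference equations $$x_n=\frac{\alpha+\sum^{k}_{i=1}\beta_{i}x_{n-i} + \sum^{k}_{i=1}\gamma_{i}y_{n-i}}{A+\sum^{k}_{j=1}B_{j}x_{n-j} + \sum^{k}_{j=1}C_{j}y_{n-j}},\qquad y_n=\frac{p+\sum^{k}_{i=1}\delta_{i}x_{n-i} + \sum^{k}_{i=1}\epsilon_{i}y_{n-i}}{q+\sum^{k}_{j=1}D_{j}x_{n-j} + \sum^{k}_{j=1}E_{j}y_{n-j}},\qquad n\in\mathbb{N},$$ with non-negative real parameters and non-negative initial conditions. Assume that there exist constants $M_1,M_2>0$ such that every solution satisfies $M_1y_n\le x_n\le M_2y_n$ for all $n\in\mathbb{N}$. Suppose that $A=0$, $\alpha=0$, and $I_\beta\cup I_\gamma\subseteq I_B\cup I_C$. Then there exist $M>0$ and $N\in\mathbb{N}$ such that every solution (from any non-negative initial conditions) satisfies $x_n\le M$ and $y_n\le M$ for all $n>N$.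
   Context: $\mathbb{N}=\{1,2,\dots\}$. Initial conditions are $x_{1-k},\dots,x_0,y_{1-k},\dots,y_0\ge 0$; a solution is a pair of sequences generated by the system from non-negative initial conditions for which all denominators are positive for every $n\in\mathbb{N}$. Index sets in $\{1,\dots,k\}$: $I_\beta=\{i:\beta_i>0\}$, $I_\gamma=\{i:\gamma_i>0\}$, $I_B=\{j:B_j>0\}$, $I_C=\{j:C_j>0\}$. *)

(* Defs.v *)
From mathcomp Require Import all_boot all_order all_algebra.
From mathcomp Require Import reals.

Set Implicit Arguments.
Unset Strict Implicit.
Unset Printing Implicit Defensive.

Import Order.TTheory GRing.Theory Num.Theory.
Local Open Scope ring_scope.

(* Lags 1, ..., k are encoded by the ordinals i : 'I_k, with i standing for the
   lag i.+1; thus [beta s i] is the coefficient of x_{n - i.+1}. *)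
Record rat_system (R : realType) (k : nat) := RatSystem {
  alpha : R; beta : 'I_k -> R; gamma : 'I_k -> R;
  A : R; B : 'I_k -> R; C : 'I_k -> R;
  p : R; delta : 'I_k -> R; epsilon : 'I_k -> R;
  q : R; D : 'I_k -> R; E : 'I_k -> R
}.

Definition nonneg_params (R : realType) (k : nat) (s : rat_system R k) : Prop :=
  [/\ [/\ 0 <= alpha s, 0 <= A s, 0 <= p s & 0 <= q s],
      forall i, [/\ 0 <= beta s i, 0 <= gamma s i, 0 <= B s i & 0 <= C s i]
    & forall i, [/\ 0 <= delta s i, 0 <= epsilon s i, 0 <= D s i & 0 <= E s i]].

Definition lag_form (R : realType) (k : nat) (c : R) (b g : 'I_k -> R)
    (x y : int -> R) (n : int) : R :=
  c + \sum_(i < k) b i * x (n - i.+1%:Z) + \sum_(i < k) g i * y (n - i.+1%:Z).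

(* Sequences are total functions on int; only their values at indices
   >= 1 - k are constrained. *)
Definition is_solution (R : realType) (k : nat) (s : rat_system R k)
    (x y : int -> R) : Prop :=
  (forall m : int, 1 - k%:Z <= m <= 0 -> 0 <= x m /\ 0 <= y m) /\
  (forall n : int, 1 <= n ->
    [/\ 0 < lag_form (A s) (B s) (C s) x y n,
        0 < lag_form (q s) (D s) (E s) x y n,
        x n = lag_form (alpha s) (beta s) (gamma s) x y n
              / lag_form (A s) (B s) (C s) x y n
      & y n = lag_form (p s) (delta s) (epsilon s) x y n
              / lag_form (q s) (D s) (E s) x y n]).

Definition pos_support (R : realType) (k : nat) (c : 'I_k -> R) : {set 'I_k} :=
  [set i | 0 < c i].

(* Main.v *)
(* For n > k all lagged values have index at least 1, where x and y are
   comparable. So each numerator term beta_i x + gamma_i y is at most a constant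
   K_i times the matching denominator term B_i x + C_i y, because one of B_i, C_i
   is positive whenever the numerator term is not identically zero. As A and
   alpha vanish, summing over i bounds x_n by the sum of the K_i, and
   M_1 y_n <= x_n then bounds y_n. *)
Require Import Defs.
From mathcomp Require Import all_boot all_order all_algebra.
From mathcomp Require Import reals.
From mathcomp Require Import zify lra.

Set Implicit Arguments.
Unset Strict Implicit.
Unset Printing Implicit Defensive.

Import Order.TTheory GRing.Theory Num.Theory.
Local Open Scope ring_scope.

Lemma lag_form_ge0 (R : realType) (k : nat) (c : R) (b g : 'I_k -> R)
    (x y : int -> R) (n : int) :
  0 <= c -> (forall i, 0 <= b i) -> (forall i, 0 <= g i) ->
  (forall i : 'I_k, 0 <= x (n - i.+1%:Z) /\ 0 <= y (n - i.+1%:Z)) ->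
  0 <= lag_form c b g x y n.
Proof.
move=> c0 b0 g0 xy0; rewrite /lag_form !addr_ge0 //; apply: sumr_ge0 => i _.
  by rewrite mulr_ge0 //; case: (xy0 i).
by rewrite mulr_ge0 //; case: (xy0 i).
Qed.

Lemma solution_ge0 (R : realType) (k : nat) (s : rat_system R k)
    (x y : int -> R) :
  nonneg_params s -> is_solution s x y ->
  forall m : int, 1 - k%:Z <= m -> 0 <= x m /\ 0 <= y m.
Proof.
move=> [[a0 _ p0 _] h1 h2] [ini rec].
(* Indices are integers, so the induction runs on a natural upper bound [j]; the initial conditions
   are the case [j = 0]. From an index [m >= 1], the largest lag [k] reaches no lower than
   [1 - k]. *)
suff nonneg_upto (j : nat) (m : int) :
    1 - k%:Z <= m <= j%:Z -> 0 <= x m /\ 0 <= y m.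
  by move=> m hm; apply: (nonneg_upto `|m|%N); lia.
elim: j m => [|j IH] m hm; first exact: ini.
have [hmj|hmj] := boolP (m <= j%:Z); first by apply: IH; lia.
have m_ge1 : 1 <= m by lia.
have [den1 den2 -> ->] := rec m m_ge1.
have prev (i : 'I_k) : 0 <= x (m - i.+1%:Z) /\ 0 <= y (m - i.+1%:Z).
  by apply: IH; have := ltn_ord i; lia.
split; apply: divr_ge0; rewrite ?(ltW den1) ?(ltW den2) //.
  by apply: lag_form_ge0 => // i; case: (h1 i).
by apply: lag_form_ge0 => // i; case: (h2 i).
Qed.

(* When b or c is zero, the corresponding quotient in the constant is zero. *)
Lemma lag_term_le (R : realType) (M1 M2 be ga b c x y : R) :
  0 < M1 -> 0 < M2 -> 0 <= be -> 0 <= ga -> 0 <= b -> 0 <= c ->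
  ((0 < be) || (0 < ga) -> (0 < b) || (0 < c)) ->
  0 <= x -> 0 <= y -> M1 * y <= x -> x <= M2 * y ->
  be * x + ga * y
    <= ((be + ga / M1) / b + (be * M2 + ga) / c) * (b * x + c * y).
Proof.
move=> M1_gt0 M2_gt0 be0 ga0 b0 c0 supp x0 y0 yx xy.
have cb0 : 0 <= (be + ga / M1) / b.
  by rewrite divr_ge0 // addr_ge0 // divr_ge0 // ltW.
have cc0 : 0 <= (be * M2 + ga) / c.
  by rewrite divr_ge0 // addr_ge0 // mulr_ge0 // ltW.
have [bg|] := boolP ((0 < be) || (0 < ga)); last first.
  rewrite negb_or -!leNgt => /andP[be_le0 ga_le0].
  have -> : be = 0 by lra.
  have -> : ga = 0 by lra.
  by rewrite !mul0r !add0r !mul0r add0r mul0r.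
have bx0 : 0 <= b * x by rewrite mulr_ge0.
have cy0 : 0 <= c * y by rewrite mulr_ge0.
(* If [b > 0], replace [y] by [x / M1] and compare with [b * x] alone; if [c > 0], replace [x] by
   [M2 * y] and compare with [c * y] alone. The other quotient and the other product are
   nonnegative, so adding them only enlarges the bound. *)
case/orP: (supp bg) => [b_gt0|c_gt0].
- apply: (@le_trans _ _ ((be + ga / M1) / b * (b * x))).
    rewrite mulrA divfK ?gt_eqF // mulrDl lerD2l -mulrA ler_wpM2l //.
    by rewrite mulrC ler_pdivlMr // mulrC.
  by apply: ler_pM => //; rewrite ?lerDl ?lerDr.
- apply: (@le_trans _ _ ((be * M2 + ga) / c * (c * y))).
    by rewrite mulrA divfK ?gt_eqF // mulrDl lerD2r -mulrA ler_wpM2l.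
  by apply: ler_pM => //; rewrite ?lerDl ?lerDr.
Qed.

(** Since the [d i] are nonnegative, each of them is at most their total, which then factors out. *)
Lemma sum_mul_le_mul_sum (R : realType) (k : nat) (f K d : 'I_k -> R) :
  (forall i, 0 <= K i) -> (forall i, 0 <= d i) ->
  (forall i, f i <= K i * d i) ->
  \sum_i f i <= (\sum_i K i) * \sum_i d i.
Proof.
move=> K0 d0 fKd; rewrite mulr_suml; apply: ler_sum => i _.
apply: le_trans (fKd i) _; apply: ler_wpM2l => //.
by rewrite (bigD1 i) //= lerDl sumr_ge0.
Qed.

Theorem theorem6 (R : realType) (k : nat) (k_gt0 : (0 < k)%N)
  (s : rat_system R k) (s_ge0 : nonneg_params s)
  (comparable_xy : exists M1 M2 : R, [/\ 0 < M1, 0 < M2 &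
     forall x y : int -> R, is_solution s x y ->
       forall n : int, 1 <= n -> M1 * y n <= x n /\ x n <= M2 * y n])
  (A_eq0 : A s = 0) (alpha_eq0 : alpha s = 0)
  (sub_supp : pos_support (beta s) :|: pos_support (gamma s)
                \subset pos_support (B s) :|: pos_support (C s)) :
  exists (M : R) (N : int), [/\ 0 < M, 1 <= N &
    forall x y : int -> R, is_solution s x y ->
      forall n : int, N < n -> x n <= M /\ y n <= M].
Proof.
have [M1 [M2 [M1_gt0 M2_gt0 cmp]]] := comparable_xy.
have [_ coef_ge0 _] := s_ge0.
pose K i := (beta s i + gamma s i / M1) / B s i
            + (beta s i * M2 + gamma s i) / C s i.
have K0 i : 0 <= K i.
  have [b0 g0 B0 C0] := coef_ge0 i.
  have M1_ge0 := ltW M1_gt0; have M2_ge0 := ltW M2_gt0.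
  by rewrite /K addr_ge0 ?divr_ge0 ?addr_ge0 ?divr_ge0 ?mulr_ge0.
pose L := \sum_i K i.
have L0 : 0 <= L by apply: sumr_ge0.
have LM0 : 0 <= L / M1 by rewrite divr_ge0 // ltW.
(* [L] will bound [x n] and [L / M1] will bound [y n]; the [1] keeps the bound positive when
   [L = 0]. Beyond [k], no lag reaches the initial conditions, which need not be comparable. *)
exists (L + L / M1 + 1), k%:Z; split; [lra|lia|move=> x y sol n kn].
have n_ge1 : 1 <= n by lia.
have xL : x n <= L.
  have [_ rec] := sol; have [den_gt0 _ -> _] := rec n n_ge1.
  (* Clear the positive denominator and pair the [x] and [y] terms of equal lag. *)
  rewrite ler_pdivrMr // /lag_form A_eq0 alpha_eq0 !add0r -!big_split /=.
  have lag_ge1 (i : 'I_k) : 1 <= n - i.+1%:Z by have := ltn_ord i; lia.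
  have xy0 (i : 'I_k) : 0 <= x (n - i.+1%:Z) /\ 0 <= y (n - i.+1%:Z).
    by apply: (solution_ge0 s_ge0 sol); have := lag_ge1 i; lia.
  apply: sum_mul_le_mul_sum => // i; have [x0 y0] := xy0 i;
    have [b0 g0 B0 C0] := coef_ge0 i.
    by rewrite addr_ge0 ?mulr_ge0.
  have [yx xy] := cmp x y sol _ (lag_ge1 i).
  apply: lag_term_le => //.
  by have /subsetP/(_ i) := sub_supp; rewrite !inE.
have [yx _] := cmp x y sol n n_ge1.
have yL : y n <= L / M1 by rewrite ler_pdivlMr // mulrC (le_trans yx).
by split; lra.
Qed.
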